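(* Consider the quadratic-bilinear (QB) system given by the real matrices $A,N_1,\dots,N_m\in\mathbb{R}^{n\times n}$, $H\in\mathbb{R}^{n\times n^2}$, $B\in\mathbb{R}^{n\times m}$, $C\in\mathbb{R}^{p\times n}$, and assume that $A$ is stable. If the reachability Gramian $P=\sum_{i=1}^\infty P_i$ of the system exists, then $P$ satisfies the generalized quadratic Lyapunov equation $$AP + PA^T + H(P\otimes P) H^T + \sum_{k=1}^m N_kPN_k^T + BB^T = 0 .$$
   Context: The QB system is $\dot x(t)=Ax(t)+H(x(t)\otimes x(t))+\sum_{k=1}^m N_kx(t)u_k(t)+Bu(t)$, $y(t)=Cx(t)$, $x(0)=0$, with state $x(t)\in\mathbb{R}^n$, input $u(t)=(u_1(t),\dots,u_m(t))^T\in\mathbb{R}^m$, output $y(t)\in\mathbb{R}^p$; $\otimes$ is the Kronecker product. A matrix is stable if all its eigenvalues have negative real part. Define the matrix-valued functions $\bar P_1(t_1)=e^{At_1}B$, $\bar P_2(t_1,t_2)=e^{At_2}[N_1,\dots,N_m]\,(I_m\otimes \bar P_1(t_1))$, and for $i\ge 3$ $$\bar P_i(t_1,\dots,t_i)=e^{At_i}\Big[H\big[\bar P_1(t_1)\otimes\bar P_{i-2}(t_2,\dots,t_{i-1}),\ \bar P_2(t_1,t_2)\otimes \bar P_{i-3}(t_3,\dots,t_{i-1}),\ \dots,\ \bar P_{i-2}(t_1,\dots,t_{i-2})\otimes\bar P_1(t_{i-1})\big],\ [N_1,\dots,N_m]\,(I_m\otimes\bar P_{i-1}(t_1,\dots,t_{i-1}))\Big],$$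 where square brackets with commas denote horizontal concatenation of blocks. The reachability Gramian is $$P=\sum_{i=1}^\infty P_i,\qquad P_i=\int_0^\infty\cdots\int_0^\infty \bar P_i(t_1,\dots,t_i)\bar P_i(t_1,\dots,t_i)^T\,dt_1\cdots dt_i ,$$ and it is said to exist if this series (of integrals) converges. *)

(* Defs.v *)
From mathcomp Require Import all_boot all_order all_algebra.
From mathcomp Require Import complex mxtens.
From mathcomp Require Import all_classical all_reals all_analysis.

Set Implicit Arguments.
Unset Strict Implicit.
Unset Printing Implicit Defensive.

Import Order.TTheory GRing.Theory Num.Theory.
Import numFieldNormedType.Exports.

Local Open Scope classical_set_scope.
Local Open Scope ring_scope.

(* The quadratic-bilinear system
     x' = A x + H (x (x) x) + \sum_k u_k N_k x + B u,   y = C x,   x(0) = 0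
   is represented by the matrices A, H, N, B, C. The Kronecker product is
   [*t]; its row and column indices are ordered as usual: (i, j) is numbered
   [i * n + j]. *)

(* All complex eigenvalues have negative real part. *)
Definition stable (R : realType) (n : nat) (A : 'M[R]_n) : Prop :=
  forall z : complex R,
    eigenvalue (map_mx (real_complex R) A) z -> complex.Re z < 0.

Definition expmx (R : realType) (n : nat) (A : 'M[R]_n) : 'M[R]_n :=
  limn (fun k : nat => \sum_(0 <= l < k) (l`!%:R^-1 : R) *: A ^+ l).

(* The horizontal concatenation [N_1, ..., N_m]. A \mxrow would have
   \sum_(k < m) n columns, whereas the factor multiplied with it has m * n
   rows. *)
Definition hcat (R : realType) (n m : nat) (N : 'I_m -> 'M[R]_n) :
    'M[R]_(n, m * n) :=
  \matrix_(i, j) N (mxtens_unindex j).1 i (mxtens_unindex j).2.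

Lemma colsub_hcat (R : realType) (n m : nat) (N : 'I_m -> 'M[R]_n) (k : 'I_m) :
  colsub (fun j => mxtens_index (k, j)) (hcat N) = N k.
Proof. by apply/matrixP => i j; rewrite !mxE mxtens_indexK. Qed.

(* Matrices with n rows and an arbitrary number of columns: the number of
   columns of Pbar_i depends on i through a recurrence. *)
Definition wmx (R : realType) (n : nat) := {q : nat & 'M[R]_(n, q)}.

Definition wmx_of (R : realType) (n q : nat) (M : 'M[R]_(n, q)) : wmx R n :=
  existT (fun q => 'M[R]_(n, q)) q M.

(* Pbar_i as a function of the list t = [:: t_1; ...; t_i]; only lists of size
   i are relevant, and Pbar_0 is a dummy empty matrix. [Pstep i F] is Pbar_i
   computed from the functions F j = Pbar_j for j < i. In the last branch,
   i = k + 3 and the block with index j is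
     Pbar_(j+1)(t_1, ..., t_(j+1)) (x) Pbar_(i-2-j)(t_(j+2), ..., t_(i-1)). *)
Definition Pstep (R : realType) (n m : nat) (A : 'M[R]_n)
    (H : 'M[R]_(n, n * n)) (N : 'I_m -> 'M[R]_n) (B : 'M[R]_(n, m))
    (i : nat) (F : nat -> seq R -> wmx R n) (t : seq R) : wmx R n :=
  match i with
  | 0 => wmx_of (0 : 'M[R]_(n, 0))
  | 1 => wmx_of (expmx (t`_0 *: A) *m B)
  | 2 => wmx_of (expmx (t`_1 *: A) *m
           (hcat N *m ((1%:M : 'M[R]_m) *t projT2 (F 1 (take 1 t)))))
  | k.+3 =>
      let s := take k.+2 t in
      wmx_of (expmx (t`_k.+2 *: A) *m
        row_mx
          (H *m \mxrow_(j < k.+1) (projT2 (F j.+1 (take j.+1 s)) *t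
                                   projT2 (F (k.+1 - j)%N (drop j.+1 s))))
          (hcat N *m ((1%:M : 'M[R]_m) *t projT2 (F k.+2 s))))
  end.

(* [Pupto k] agrees with Pbar_i for all i <= k. *)
Fixpoint Pupto (R : realType) (n m : nat) (A : 'M[R]_n)
    (H : 'M[R]_(n, n * n)) (N : 'I_m -> 'M[R]_n) (B : 'M[R]_(n, m))
    (k : nat) : nat -> seq R -> wmx R n :=
  match k with
  | 0 => fun _ => Pstep A H N B 0 (fun _ _ => wmx_of (0 : 'M[R]_(n, 0)))
  | k'.+1 => fun i => if (i <= k')%N then Pupto A H N B k' i
                      else Pstep A H N B k'.+1 (Pupto A H N B k')
  end.

Definition Pbar (R : realType) (n m : nat) (A : 'M[R]_n)
    (H : 'M[R]_(n, n * n)) (N : 'I_m -> 'M[R]_n) (B : 'M[R]_(n, m))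
    (i : nat) (t : seq R) : wmx R n :=
  Pupto A H N B i i t.

Lemma PuptoE (R : realType) (n m : nat) (A : 'M[R]_n) (H : 'M[R]_(n, n * n))
    (N : 'I_m -> 'M[R]_n) (B : 'M[R]_(n, m)) (k i : nat) :
  (i <= k)%N -> Pupto A H N B k i = Pbar A H N B i.
Proof.
elim: k => [|k IHk]; first by rewrite leqn0 => /eqP->.
rewrite leq_eqVlt ltnS => /predU1P[->//|leik].
by rewrite /= leik IHk.
Qed.

Lemma Pbar1E (R : realType) (n m : nat) (A : 'M[R]_n) (H : 'M[R]_(n, n * n))
    (N : 'I_m -> 'M[R]_n) (B : 'M[R]_(n, m)) (t1 : R) :
  Pbar A H N B 1 [:: t1] = wmx_of (expmx (t1 *: A) *m B).
Proof. by []. Qed.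

Lemma Pbar2E (R : realType) (n m : nat) (A : 'M[R]_n) (H : 'M[R]_(n, n * n))
    (N : 'I_m -> 'M[R]_n) (B : 'M[R]_(n, m)) (t1 t2 : R) :
  Pbar A H N B 2 [:: t1; t2] =
  wmx_of (expmx (t2 *: A) *m
    (hcat N *m ((1%:M : 'M[R]_m) *t projT2 (Pbar A H N B 1 [:: t1])))).
Proof. by []. Qed.

Lemma Pbar_rcons (R : realType) (n m : nat) (A : 'M[R]_n)
    (H : 'M[R]_(n, n * n)) (N : 'I_m -> 'M[R]_n) (B : 'M[R]_(n, m))
    (k : nat) (s : seq R) (u : R) (P := Pbar A H N B) :
  size s = k.+2 ->
  P k.+3 (rcons s u) = wmx_of (expmx (u *: A) *m
    row_mx
      (H *m \mxrow_(j < k.+1) (projT2 (P j.+1 (take j.+1 s)) *t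
                               projT2 (P (k.+1 - j)%N (drop j.+1 s))))
      (hcat N *m ((1%:M : 'M[R]_m) *t projT2 (P k.+2 s)))).
Proof.
move=> szs.
have -> : P k.+3 (rcons s u) =
    Pstep A H N B k.+3 (Pupto A H N B k.+2) (rcons s u).
  by rewrite /P /Pbar [LHS]/= ltnn.
pose blocks (v : R) (w : seq R) (X Y : 'I_k.+1 -> seq R -> wmx R n)
    (Z : seq R -> wmx R n) := wmx_of (expmx (v *: A) *m row_mx
    (H *m \mxrow_(j < k.+1) (projT2 (X j (take j.+1 w)) *t
                             projT2 (Y j (drop j.+1 w))))
    (hcat N *m ((1%:M : 'M[R]_m) *t projT2 (Z w)))).
pose F := Pupto A H N B k.+2.
change (blocks (rcons s u)`_k.+2 (take k.+2 (rcons s u))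
          (fun j => F j.+1) (fun j => F (k.+1 - j)%N) (F k.+2) =
        blocks u s (fun j => P j.+1) (fun j => P (k.+1 - j)%N) (P k.+2)).
have -> : (rcons s u)`_k.+2 = u by rewrite nth_rcons szs ltnn eqxx.
have -> : take k.+2 (rcons s u) = s by rewrite -cats1 take_size_cat.
have -> : (fun j : 'I_k.+1 => F j.+1) = (fun j => P j.+1).
  by apply/funext => j; apply: PuptoE; rewrite ltnS ltnW.
have -> : (fun j : 'I_k.+1 => F (k.+1 - j)%N) = (fun j => P (k.+1 - j)%N).
  by apply/funext => j; apply: PuptoE; rewrite (leq_trans (leq_subr _ _)).
by rewrite /F PuptoE.
Qed.

(* \int_0^oo ... \int_0^oo f(t_1, ..., t_i) dt_1 ... dt_i, where t_1 is the
   innermost variable. *)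
Fixpoint iterated_integral (R : realType) (i : nat) (f : seq R -> R) : R :=
  match i with
  | 0 => f [::]
  | k.+1 => \int[@lebesgue_measure R]_(s in `[0, +oo[)
              iterated_integral k (fun t => f (rcons t s))
  end.

Definition gramian_term (R : realType) (n m : nat) (A : 'M[R]_n)
    (H : 'M[R]_(n, n * n)) (N : 'I_m -> 'M[R]_n) (B : 'M[R]_(n, m))
    (i : nat) : 'M[R]_n :=
  \matrix_(a, b) iterated_integral i (fun t =>
    (projT2 (Pbar A H N B i t) *m (projT2 (Pbar A H N B i t))^T) a b).

Definition gramian_partial_sum (R : realType) (n m : nat) (A : 'M[R]_n)
    (H : 'M[R]_(n, n * n)) (N : 'I_m -> 'M[R]_n) (B : 'M[R]_(n, m))
    (k : nat) : 'M[R]_n :=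
  \sum_(1 <= i < k.+1) gramian_term A H N B i.

Definition reachability_gramian_exists (R : realType) (n m : nat) (A : 'M[R]_n)
    (H : 'M[R]_(n, n * n)) (N : 'I_m -> 'M[R]_n) (B : 'M[R]_(n, m)) : Prop :=
  cvgn (gramian_partial_sum A H N B).

Definition reachability_gramian (R : realType) (n m : nat) (A : 'M[R]_n)
    (H : 'M[R]_(n, n * n)) (N : 'I_m -> 'M[R]_n) (B : 'M[R]_(n, m)) :
    'M[R]_n :=
  limn (gramian_partial_sum A H N B).

(* Main.v *)
(* Let G_i be the integrand Pbar_i Pbar_i^T. The block structure of Pbar_i gives
     G_(i+1)(t, u) = e^(A u) Q_i(t) e^(A^T u),
   where Q_i is the sum of H (\sum_j G_j (x) G_(i-j)) H^T, of
   \sum_k N_k G_i N_k^T and, for i = 0, of B B^T. The factors of the Kronecker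
   products depend on disjoint groups of variables, so the iterated integrals
   factor, and integrating the derivative of e^(A u) M e^(A^T u) over [0, +oo[
   turns the recurrence into a Lyapunov equation relating P_(i+1) to
   P_0, ..., P_i. These equations are summed over i; the quadratic terms form a
   Cauchy product, which converges because the entries of the positive
   semidefinite matrix P_i are bounded by its trace, and the traces are summable.

   The exponential decay of e^(A s) is obtained from the Cayley-Hamilton theorem:
   if W_k is the product of the first k linear factors of the characteristic
   polynomial at A, then W_k e^(A s) solves a scalar equation with eigenvalue
   lambda_k forced by W_(k+1) e^(A s), and a weighted sum of the squared norms of
   these functions is a Lyapunov function. *)
Require Import Defs.
From mathcomp Require Import all_boot all_order all_algebra.
From mathcomp Require Import complex mxtens.
From mathcomp Require Import all_classical all_reals all_analysis.
From mathcomp Require Import measurable_realfun ring lra.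
Import Order.TTheory GRing.Theory Num.Theory.
Import numFieldNormedType.Exports.
Local Open Scope ring_scope.

Set Implicit Arguments.
Unset Strict Implicit.
Unset Printing Implicit Defensive.
Local Open Scope classical_set_scope.

(** * Entrywise limits of matrix sequences *)

Section MatrixLimits.
Variable R : realType.

Lemma cvg_mx_coord (p q : nat) (F : nat -> 'M[R]_(p, q)) (L : 'M[R]_(p, q)) :
  (forall i j, F k i j @[k --> \oo] --> L i j) -> F k @[k --> \oo] --> L.
Proof.
move=> FL B [P PL sPB]; apply: filterS (_ : \forall k \near \oo,
  forall i j, P i j (F k i j)); first by move=> k; exact: sPB.
by apply: filter_forall => i; apply: filter_forall => j; apply: FL; exact: PL.
Qed.

Lemma mx_coord_cvg (p q : nat) (F : nat -> 'M[R]_(p, q)) (L : 'M[R]_(p, q))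
    i j :
  F k @[k --> \oo] --> L -> F k i j @[k --> \oo] --> L i j.
Proof.
by move=> FL; exact: (cvg_comp F (fun M : 'M[R]_(p, q) => M i j) FL
  (@coord_continuous _ _ _ i j L)).
Qed.

Lemma cvg_sumr (I : finType) (F : I -> nat -> R) (L : I -> R) :
  (forall i, F i k @[k --> \oo] --> L i) ->
  \sum_i F i k @[k --> \oo] --> \sum_i L i.
Proof. by move=> FL; apply: cvg_big => //; exact: add_continuous. Qed.

Lemma cvg_mulmxl (p q r : nat) (M : 'M[R]_(p, q)) (F : nat -> 'M[R]_(q, r))
    (L : 'M[R]_(q, r)) :
  F k @[k --> \oo] --> L -> M *m F k @[k --> \oo] --> M *m L.
Proof.
move=> FL; apply: cvg_mx_coord => i j; rewrite mxE.
under eq_cvg do rewrite mxE.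
by apply: cvg_sumr => l; apply: cvgM; [exact: cvg_cst|exact: mx_coord_cvg].
Qed.

Lemma cvg_mulmxr (p q r : nat) (M : 'M[R]_(q, r)) (F : nat -> 'M[R]_(p, q))
    (L : 'M[R]_(p, q)) :
  F k @[k --> \oo] --> L -> F k *m M @[k --> \oo] --> L *m M.
Proof.
move=> FL; apply: cvg_mx_coord => i j; rewrite mxE.
under eq_cvg do rewrite mxE.
by apply: cvg_sumr => l; apply: cvgM; [exact: mx_coord_cvg|exact: cvg_cst].
Qed.

Lemma cvg_addmx (p q : nat) (F G : nat -> 'M[R]_(p, q))
    (L M : 'M[R]_(p, q)) :
  F k @[k --> \oo] --> L -> G k @[k --> \oo] --> M ->
  F k + G k @[k --> \oo] --> L + M.
Proof.
move=> FL GM; apply: cvg_mx_coord => i j; rewrite mxE.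
by under eq_cvg do rewrite mxE; apply: cvgD; exact: mx_coord_cvg.
Qed.

Lemma cvg_summx (I : finType) (p q : nat) (F : I -> nat -> 'M[R]_(p, q))
    (L : I -> 'M[R]_(p, q)) :
  (forall i, F i k @[k --> \oo] --> L i) ->
  \sum_i F i k @[k --> \oo] --> \sum_i L i.
Proof.
move=> FL; apply: cvg_mx_coord => i j; rewrite summxE.
by under eq_cvg do rewrite summxE; apply: cvg_sumr => l; exact: mx_coord_cvg.
Qed.

End MatrixLimits.

(** * Derivatives of matrix-valued functions *)

Section MatrixDerivative.
Variable R : realType.

(** Entrywise, so that it covers matrices of every size and reduces to the scalar rules. *)
Definition mxderive (p q : nat) (F : R -> 'M[R]_(p, q)) (x : R)
    (D : 'M[R]_(p, q)) :=
  forall i j, is_derive x (1 : R) (fun s => F s i j) (D i j).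

Lemma is_derive_sumr (I : finType) (f : I -> R -> R) (x : R) (df : I -> R) :
  (forall i, is_derive x (1 : R) (f i) (df i)) ->
  is_derive x (1 : R) (fun s => \sum_i f i s) (\sum_i df i).
Proof.
move=> fd; rewrite (_ : (fun s => _) = \sum_i f i); last first.
  by apply/funext => s; rewrite fct_sumE.
by elim/big_rec2: _ => [|i F dF _ ?]; [exact: is_derive_cst|exact: is_deriveD].
Qed.

Lemma mxderive_cst (p q : nat) (M : 'M[R]_(p, q)) x : mxderive (fun=> M) x 0.
Proof. by move=> i j; rewrite mxE; exact: is_derive_cst. Qed.

Lemma mxderive_addmx (p q : nat) (F G : R -> 'M[R]_(p, q)) x D E :
  mxderive F x D -> mxderive G x E ->
  mxderive (fun s => F s + G s) x (D + E).
Proof.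
move=> FD GE i j; under eq_fun do rewrite mxE.
by rewrite mxE; exact: (is_deriveD (FD i j) (GE i j)).
Qed.

Lemma mxderive_trmx (p q : nat) (F : R -> 'M[R]_(p, q)) x D :
  mxderive F x D -> mxderive (fun s => (F s)^T) x D^T.
Proof. by move=> FD i j; under eq_fun do rewrite mxE; rewrite mxE. Qed.

Lemma mxderive_mulmx (p q r : nat) (F : R -> 'M[R]_(p, q))
    (G : R -> 'M[R]_(q, r)) x D E :
  mxderive F x D -> mxderive G x E ->
  mxderive (fun s => F s *m G s) x (D *m G x + F x *m E).
Proof.
move=> FD GE i j; under eq_fun do rewrite mxE.
rewrite !mxE -big_split/=; apply: is_derive_sumr => k.
apply: (is_derive_eq (is_deriveM (FD i k) (GE k j))).
by rewrite /GRing.scale/= addrC [G x k j * _]mulrC.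
Qed.

End MatrixDerivative.

(** * The matrix exponential as a family of power series *)

Section MatrixExponential.
Variables (R : realType) (n : nat).
Implicit Type A : 'M[R]_n.

(** Comparison with [M] times the exponential series at [K * |x|]. *)
Lemma factorial_bounded_pseries_cvg (c : R^nat) (M K x : R) :
  0 <= M -> 0 <= K ->
  (forall l, `|c l| <= l`!%:R^-1 * (M * K ^+ l)) -> cvgn (pseries c x).
Proof.
move=> M0 K0 cMK; apply: normed_cvg.
have : cvgn (series (M *: exp_coeff (K * `|x|))).
  by apply: is_cvg_seriesZ; exact: is_cvg_series_exp_coeff.
rewrite exp_coeffE (_ : M *: _ = fun l => M * (l`!%:R^-1 * (K * `|x|) ^+ l))//.
apply: series_le_cvg => l /=; first exact: normr_ge0.
  by rewrite !mulr_ge0// ?invr_ge0// exprn_ge0 ?mulr_ge0.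
rewrite normrM normrX exprMn.
by rewrite mulrCA !mulrA ler_wpM2r ?exprn_ge0// -mulrA.
Qed.

(** The sum of all [|A i j|] dominates every absolute row sum, so each further factor [A] multiplies
    a bound on the entries by at most this constant. *)
Lemma normr_exprmx_le A :
  exists2 K, 0 <= K & forall l i j, `|(A ^+ l) i j| <= K ^+ l.
Proof.
exists (\sum_i \sum_j `|A i j|) => [|l].
  by apply: sumr_ge0 => i _; exact: sumr_ge0.
elim: l => [|l IHl] i j.
  by rewrite !expr0 mxE; case: (i == j); rewrite ?normr1 ?normr0.
rewrite !exprS -mulmxE mxE (le_trans (ler_norm_sum _ _ _))//.
apply: (@le_trans _ _ (\sum_k `|A i k| * (\sum_i \sum_j `|A i j|) ^+ l)).
  by apply: ler_sum => k _; rewrite normrM ler_wpM2l.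
rewrite -mulr_suml ler_wpM2r ?exprn_ge0//.
  by apply: sumr_ge0 => k _; exact: sumr_ge0.
rewrite [leRHS](bigD1 i)//= lerDl.
by apply: sumr_ge0 => k _; exact: sumr_ge0.
Qed.

Definition exp_coef_mx A i j (l : nat) : R := l`!%:R^-1 * (A ^+ l) i j.

(** Each formal differentiation cancels one factor of the factorial and shifts the power of [A]; the
    result is the series of an entry of A^d e^(A s). *)
Lemma pseries_diffs_exp_coef_mx A i j d :
  iter d (@pseries_diffs R) (exp_coef_mx A i j) =
  (fun l => l`!%:R^-1 * (A ^+ (l + d)) i j).
Proof.
elim: d => [|d IHd]; first by under [RHS]eq_fun do rewrite addn0.
apply/funext => l; rewrite iterS IHd /pseries_diffs factS natrM invfM mulrA.
by rewrite mulrA mulfV ?pnatr_eq0// mul1r addSnnS.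
Qed.

Lemma exp_coef_mx_cvg A i j d x :
  cvgn (pseries (iter d (@pseries_diffs R) (exp_coef_mx A i j)) x).
Proof.
have [K K0 AK] := normr_exprmx_le A.
apply: (@factorial_bounded_pseries_cvg _ (K ^+ d) K) => // [|l].
  exact: exprn_ge0.
rewrite pseries_diffs_exp_coef_mx normrM ger0_norm ?invr_ge0//.
by rewrite ler_wpM2l ?invr_ge0// mulrC -exprD.
Qed.

Lemma exprmxZ (a : R) A l : (a *: A) ^+ l = a ^+ l *: A ^+ l.
Proof.
elim: l => [|l IHl]; first by rewrite !expr0 scale1r.
by rewrite !exprS IHl -!mulmxE -scalemxAl -scalemxAr scalerA.
Qed.

Lemma expmxE A i j s :
  expmx (s *: A) i j = limn (pseries (exp_coef_mx A i j) s).
Proof.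
rewrite /expmx.
have EL : (fun k : nat => \sum_(0 <= l < k) (l`!%:R^-1 : R) *: (s *: A) ^+ l)
    @ \oo --> \matrix_(i, j) limn (pseries (exp_coef_mx A i j) s).
  apply: cvg_mx_coord => a b; rewrite mxE.
  have := @exp_coef_mx_cvg A a b 0 s.
  apply: cvg_trans; apply: near_eq_cvg; near=> k.
  rewrite summxE; apply: eq_bigr => l _.
  by rewrite mxE exprmxZ mxE /exp_coef_mx mulrA mulrAC.
have /(cvg_lim (@Rhausdorff R)) <- :=
  @mx_coord_cvg _ _ _ _ _ i j (cvgP _ EL).
have /(cvg_lim (@Rhausdorff R)) -> := @mx_coord_cvg _ _ _ _ _ i j EL.
by rewrite mxE.
Unshelve. all: by end_near. Qed.

Lemma expmx0 A : expmx (0 *: A) = 1%:M.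
Proof.
apply/matrixP => i j; rewrite expmxE.
apply: lim_near_cst => //.
(* The partial sums equal the identity only from [m = 1] on, since the empty one is 0. *)
near=> m; rewrite -[m]prednK; last by near: m.
rewrite /pseries/series/= big_nat_recl// big1 ?addr0 => [|l _].
  by rewrite /exp_coef_mx fact0 invr1 !expr0 mul1r mulr1.
by rewrite expr0n mulr0.
Unshelve. all: by end_near. Qed.

Lemma mxderive_expmx A x :
  mxderive (fun s => expmx (s *: A)) x (A *m expmx (x *: A)).
Proof.
move=> i j; under eq_fun do rewrite expmxE.
(* Termwise differentiation at [x] needs the series and its first two formal derivatives to converge
   at a point of larger modulus; [|x| + 1] is such a point. *)
have cK d := @exp_coef_mx_cvg A i j d (`|x| + 1).
have xK : `|x| < `|(`|x| + 1 : R)|.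
  by rewrite [ltRHS]ger0_norm ?ltrDl// addr_ge0.
apply: (is_derive_eq (pseries_snd_diffs (cK 0) (cK 1) (cK 2) xK)).
apply/cvg_lim => //; rewrite mxE.
have : \sum_k (A i k * series (fun l => exp_coef_mx A k j l * x ^+ l) m)
    @[m --> \oo] --> \sum_k A i k * expmx (x *: A) k j.
  apply: cvg_sumr => k; apply: cvgM; first exact: cvg_cst.
  by rewrite expmxE; exact: (@exp_coef_mx_cvg A k j 0).
apply: cvg_trans; apply: near_eq_cvg; near=> m.
under eq_bigr do rewrite mulr_sumr.
rewrite exchange_big/=; apply: eq_bigr => l _.
have /= -> := @pseries_diffs_exp_coef_mx A i j 1.
rewrite addn1 exprS -mulmxE mxE.
rewrite mulr_sumr mulr_suml; apply: eq_bigr => k _.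
by rewrite /exp_coef_mx; ring.
Unshelve. all: by end_near. Qed.

Lemma mxderive_lyapunov A M x :
  mxderive (fun s => expmx (s *: A) *m M *m (expmx (s *: A))^T) x
    (A *m (expmx (x *: A) *m M *m (expmx (x *: A))^T) +
     expmx (x *: A) *m M *m (expmx (x *: A))^T *m A^T).
Proof.
have dE := @mxderive_expmx A x.
have := mxderive_mulmx (mxderive_mulmx dE (@mxderive_cst R n n M x))
  (mxderive_trmx dE).
by rewrite mulmx0 addr0 trmx_mul !mulmxA.
Qed.

End MatrixExponential.

(** * Exponential decay of e^(A s) for stable A *)

Section Decay.
Variables (R : realType) (n : nat).
Implicit Type A : 'M[R]_n.+1.

Lemma is_derive_continuous (F dF : R -> R) :
  (forall s, is_derive s (1 : R) F (dF s)) -> continuous F.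
Proof.
move=> dFE s; apply: differentiable_continuous; apply/derivable1_diffP.
exact: (@ex_derive _ _ _ _ _ _ _ (dFE s)).
Qed.

Lemma is_derive_expRM (b s : R) :
  is_derive s (1 : R) (fun t => expR (b * t)) (b * expR (b * s)).
Proof.
have bid : is_derive s (1 : R) (b *: id) b.
  by apply: is_derive_eq; rewrite /GRing.scale/= mulr1.
apply: (is_derive_eq (is_derive1_comp (is_derive_expR _) bid)).
by rewrite mulrC.
Qed.

(** Gronwall's argument: [g t * expR (b * t)] has nonpositive derivative. *)
Lemma le_exp_decay (g dg : R -> R) (b : R) :
  (forall s, is_derive s (1 : R) g (dg s)) ->
  (forall s, dg s <= - b * g s) ->
  forall s, 0 <= s -> g s <= g 0 * expR (- b * s).
Proof.
move=> gd dgle s s0.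
pose h t := g t * expR (b * t).
have hd t : is_derive t (1 : R) h ((dg t + b * g t) * expR (b * t)).
  apply: (is_derive_eq (is_deriveM (gd t) (is_derive_expRM b t))).
  by rewrite /GRing.scale/=; ring.
have hc : {within `[0, +oo[, continuous h}.
  by apply: continuous_subspaceT; exact: is_derive_continuous hd.
have : h s <= h 0.
  apply: (@ler0_derive1_nincry R h 0 _ _ hc) => // t _.
  rewrite derive1E (@derive_val _ _ _ _ _ _ _ (hd t)).
  by rewrite mulr_le0_ge0 ?expR_ge0//; have := dgle t; lra.
rewrite /h mulr0 expR0 mulr1 mulNr expRN => hs.
by rewrite -ler_pdivrMr ?invr_gt0 ?expR_gt0// invrK.
Qed.

Lemma normrM_le_sqr (x y e : R) : x ^+ 2 <= e -> y ^+ 2 <= e -> `|x * y| <= e.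
Proof.
rewrite -[x ^+ 2]real_normK ?num_real// -[y ^+ 2]real_normK ?num_real// normrM.
by have := sqr_ge0 (`|x| - `|y|); nra.
Qed.

Lemma lt0_uniform (mu : nat -> R) N :
  (forall k, (k < N)%N -> mu k < 0) ->
  exists2 a, 0 < a & forall k, (k < N)%N -> mu k <= - a.
Proof.
elim: N => [|N IHN] mu0; first by exists 1.
have [|a a0 mua] := IHN; first by move=> k kN; apply: mu0; rewrite ltnW.
exists (Num.min a (- mu N)) => [|k].
  by rewrite lt_min a0 oppr_gt0 mu0.
rewrite ltnS leq_eqVlt lerNr ge_min => /predU1P[->|kN].
  by rewrite lexx orbT.
by rewrite lerNr mua.
Qed.

(* [U k + i V k] is the product of the first k factors [A - (mu j + i nu j)] of
   the characteristic polynomial of [A] evaluated at [A]. *)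
Lemma stable_factor_chain A : stable A ->
  exists (N : nat) (U V : nat -> 'M[R]_n.+1) (mu nu : nat -> R),
  [/\ U 0 = 1%:M, U N = 0, V N = 0, forall k, (k < N)%N -> mu k < 0 &
      forall k, (k < N)%N ->
        U k *m A = mu k *: U k - nu k *: V k + U k.+1 /\
        V k *m A = mu k *: V k + nu k *: U k + V k.+1].
Proof.
move=> sA; pose Ac := map_mx (real_complex R) A.
have [r charE] := closed_field_poly_normal (char_poly Ac).
rewrite (monicP (char_poly_monic Ac)) scale1r in charE.
pose W k := \prod_(z <- take k r) (Ac - z%:M).
pose Re := @complex.Re R; pose Im := @complex.Im R.
have ReD : {morph Re : x y / x + y} by move=> [? ?] [? ?].
have ImD : {morph Im : x y / x + y} by move=> [? ?] [? ?].
have ReM x y : Re (x * y) = Re x * Re y - Im x * Im y by case: x y => ? ? [].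
have ImM x y : Im (x * y) = Re x * Im y + Im x * Re y by case: x y => ? ? [].
exists (size r), (fun k => map_mx Re (W k)), (fun k => map_mx Im (W k)).
exists (fun k => Re r`_k), (fun k => Im r`_k).
(* The full product is the characteristic polynomial at [Ac], which vanishes by Cayley-Hamilton. *)
have W0 : W (size r) = 0.
  rewrite /W take_size -(Cayley_Hamilton Ac) charE rmorph_prod.
  by apply: eq_bigr => z _; rewrite rmorphB/= horner_mx_X horner_mx_C.
split.
- rewrite /W take0 big_nil; apply/matrixP => i j; rewrite !mxE.
  by case: (i == j).
- by rewrite W0; apply/matrixP => i j; rewrite !mxE.
- by rewrite W0; apply/matrixP => i j; rewrite !mxE.
- move=> k kr; apply: sA; rewrite eigenvalue_root_char -/Ac charE.
  by rewrite root_prod_XsubC mem_nth.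
move=> k kr.
(* [W k.+1] is [W k] times [Ac] minus the k-th root. As [Ac] has real entries, the real and
   imaginary parts of this identity are the two claimed recurrences. *)
have WS : W k *m Ac = r`_k *: W k + W k.+1.
  rewrite /W (take_nth 0 kr) big_rcons/= -mulmxE mulmxBr mul_mx_scalar.
  by rewrite addrC subrK.
have WSE i j : \sum_l W k i l * real_complex R (A l j) =
    r`_k * W k i j + W k.+1 i j.
  have := congr1 (fun M : matrix (complex R) _ _ => M i j) WS.
  rewrite !mxE => <-.
  by apply: eq_bigr => l _; rewrite mxE.
split; apply/matrixP => i j; have := WSE i j.
  move=> /(congr1 Re); rewrite (big_morph _ ReD (erefl : Re 0 = 0)) ReD ReM.
  rewrite !mxE => <-.
  by apply: eq_bigr => l _; rewrite ReM !mxE/= mulr0 subr0.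
move=> /(congr1 Im); rewrite (big_morph _ ImD (erefl : Im 0 = 0)) ImD ImM.
rewrite !mxE => <-.
by apply: eq_bigr => l _; rewrite ImM !mxE/= mulr0 add0r.
Qed.

(** Products of two entries are bounded, because the Lyapunov function controls squares and the
    entries of e^(A s) M e^(A^T s) are combinations of such products; no square root has to be
    taken. *)
Lemma stable_expmx_decay A : stable A ->
  exists2 b, 0 < b & exists2 K, 0 <= K &
    forall s i j k l, 0 <= s ->
      `|expmx (s *: A) i j * expmx (s *: A) k l| <= K * expR (- b * s).
Proof.
move=> sA.
have [N [U [V [mu [nu [U0 UN VN mu_lt0 UVA]]]]]] := stable_factor_chain sA.
have [a a0 mua] := lt0_uniform mu_lt0.
pose X (s : R) := expmx (s *: A).
pose u k s i j := (U k *m X s) i j; pose v k s i j := (V k *m X s) i j.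
(* The squared Frobenius norm of (U k + i V k) e^(A s). *)
pose E k s : R := \sum_i \sum_j (u k s i j ^+ 2 + v k s i j ^+ 2).
pose dE k s : R := \sum_i \sum_j (2 * u k s i j * (U k *m A *m X s) i j
   + 2 * v k s i j * (V k *m A *m X s) i j).
have E0 k s : 0 <= E k s.
  by apply: sumr_ge0 => i _; apply: sumr_ge0 => j _; rewrite addr_ge0 ?sqr_ge0.
have EN s : E N s = 0.
  rewrite /E big1// => i _; rewrite big1// => j _.
  by rewrite /u /v UN VN !mul0mx !mxE expr0n addr0.
have dEk k s : is_derive s (1 : R) (E k) (dE k s).
  apply: is_derive_sumr => i; apply: is_derive_sumr => j.
  have X' := @mxderive_expmx _ _ A s.
  have du : is_derive s (1 : R) (fun s => u k s i j) ((U k *m A *m X s) i j).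
    have := mxderive_mulmx (@mxderive_cst R _ _ (U k) s) X' i j.
    by rewrite mul0mx add0r mulmxA.
  have dv : is_derive s (1 : R) (fun s => v k s i j) ((V k *m A *m X s) i j).
    have := mxderive_mulmx (@mxderive_cst R _ _ (V k) s) X' i j.
    by rewrite mul0mx add0r mulmxA.
  apply: (is_derive_eq (is_deriveD (is_deriveM du du) (is_deriveM dv dv))).
  by rewrite /GRing.scale/=; ring.
(* The [nu] terms cancel between the two parts. The [mu] terms give at most [-2 a E k], and the
   AM-GM inequality for the forcing terms gives back [a E k]. *)
have dEle k s : (k < N)%N -> dE k s <= - a * E k s + a^-1 * E k.+1 s.
  move=> kN; rewrite /dE /E !mulr_sumr -big_split; apply: ler_sum => i _ /=.
  rewrite !mulr_sumr -big_split; apply: ler_sum => j _ /=.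
  have [UA VA] := UVA _ kN; rewrite UA VA !(mulmxDl, mulNmx) -!scalemxAl !mxE.
  have uE k' : \sum_l U k' i l * X s l j = u k' s i j by rewrite /u mxE.
  have vE k' : \sum_l V k' i l * X s l j = v k' s i j by rewrite /v mxE.
  rewrite !uE !vE; move: (u k s i j) (v k s i j) => p q.
  move: (u k.+1 s i j) (v k.+1 s i j) => p' q'.
  have amgm x y : 2 * x * y <= a * x ^+ 2 + a^-1 * y ^+ 2.
    rewrite -subr_ge0 (_ : _ - _ = a^-1 * (a * x - y) ^+ 2).
      by rewrite mulr_ge0 ?sqr_ge0// invr_ge0 ltW.
    by field; rewrite gt_eqF.
  have pq0 : 0 <= p ^+ 2 + q ^+ 2 by rewrite addr_ge0 ?sqr_ge0.
  have := ler_wpM2r pq0 (mua _ kN); have := amgm p p'; have := amgm q q'.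
  by nra.
(* With these weights the terms [a^-1 * E k.+1] absorb only half of the decay. *)
pose K := 2 / a ^+ 2.
pose W s := \sum_(k < N) K ^+ k * E k s.
have dW s : is_derive s (1 : R) W (\sum_(k < N) K ^+ k * dE k s).
  by apply: is_derive_sumr => k; exact: is_deriveZ.
have K0 : 0 < K by rewrite divr_gt0 ?exprn_gt0.
have dWle s : \sum_(k < N) K ^+ k * dE k s <= - (a / 2) * W s.
  (* Shift of index: the added top term is zero by [EN], and the bottom term is nonnegative. *)
  have shift : \sum_(k < N) K ^+ k * E k.+1 s <= K^-1 * W s.
    rewrite (_ : W s = \sum_(k < N.+1) K ^+ k * E k s); last first.
      by rewrite big_ord_recr/= EN mulr0 addr0.
    rewrite big_ord_recl/= mulrDr -[leLHS]add0r lerD//.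
      by rewrite !mulr_ge0 ?invr_ge0 ?exprn_ge0 ?E0 ?(ltW K0).
    rewrite [leRHS]mulr_sumr; apply: ler_sum => k _.
    rewrite [K ^+ bump 0 k]exprS mulrA [K^-1 * _]mulrA mulVf ?mul1r//.
    by rewrite gt_eqF.
  apply: (@le_trans _ _
      (\sum_(k < N) (- a * (K ^+ k * E k s) + a^-1 * (K ^+ k * E k.+1 s)))).
    apply: ler_sum => k _; rewrite mulrCA [a^-1 * _]mulrCA -mulrDr.
    by rewrite ler_wpM2l ?exprn_ge0 ?dEle// ltW.
  rewrite big_split/= -!mulr_sumr -/(W s).
  apply: (@le_trans _ _ (- a * W s + a^-1 * (K^-1 * W s))).
    by rewrite lerD2l ler_wpM2l ?invr_ge0 ?(ltW a0).
  rewrite le_eqVlt; apply/orP; left; apply/eqP; rewrite /K.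
  by field; rewrite gt_eqF.
have Wdecay := le_exp_decay dW dWle.
exists (a / 2); first by rewrite divr_gt0.
exists (W 0) => [|s i j k l s0].
  by apply: sumr_ge0 => k _; rewrite mulr_ge0 ?exprn_ge0 ?E0// ltW.
apply: le_trans (Wdecay s s0).
have E0W : E 0 s <= W s.
  (* If [N = 0] the sum is empty, but then [E 0] is [E N], which is 0. *)
  rewrite /W; case: N EN {UN VN mu_lt0 UVA mua dEle W dW dWle Wdecay} => [->|N _].
    by rewrite big_ord0.
  rewrite big_ord_recl expr0 mul1r lerDl sumr_ge0// => m _.
  by rewrite mulr_ge0 ?exprn_ge0// ltW.
apply: le_trans E0W.
have XE i' j' : X s i' j' ^+ 2 <= E 0 s.
  rewrite /E (bigD1 i')//= (bigD1 j')//= /u U0 mul1mx -!addrA lerDl.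
  rewrite addr_ge0 ?sqr_ge0// addr_ge0//.
    by apply: sumr_ge0 => m _; rewrite addr_ge0 ?sqr_ge0.
  by do 2 (apply: sumr_ge0 => ? _); rewrite addr_ge0 ?sqr_ge0.
by apply: normrM_le_sqr; exact: XE.
Qed.

End Decay.

(** * Integrals over the half-line under exponential bounds *)

Section HalfLineIntegral.
Variable R : realType.
Local Notation mu := (@lebesgue_measure R).
Implicit Types (f F : R -> R) (b K : R).

Lemma cvg_expRM b : 0 < b -> expR (- b * s) @[s --> +oo] --> (0 : R).
Proof.
move=> b0; under eq_fun do rewrite mulNr.
apply: (@cvg_comp _ _ _ (fun s => b * s) (fun s => expR (- s))).
  by apply: gt0_cvgMry b0 _; exact: cvg_id.
exact: cvgr_expR.
Qed.

Lemma ge0_FTC_infty F f :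
  (forall s, 0 <= s -> 0 <= f s) -> continuous f ->
  (forall s, is_derive s (1 : R) F (f s)) ->
  F s @[s --> +oo] --> (0 : R) ->
  (\int[mu]_(s in `[0%R, +oo[) (f s)%:E = (- F 0%R)%:E)%E.
Proof.
move=> f0 fc FE F0.
have Fc := is_derive_continuous FE.
rewrite (@ge0_continuous_FTC2y _ _ F _ 0)//.
- by rewrite sub0e.
- exact: continuous_subspaceT.
- by apply: cvg_at_right_filter; exact: Fc.
by move=> s _; rewrite derive1E (@derive_val _ _ _ _ _ _ _ (FE s)).
Qed.

Lemma FTC_infty_exp b : 0 < b ->
  (\int[mu]_(s in `[0%R, +oo[) (expR (- b * s))%:E = b^-1%:E)%E.
Proof.
move=> b0; have bE s : is_derive s (1 : R) (fun s => - b^-1 * expR (- b * s))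
    (expR (- b * s)).
  apply: (is_derive_eq (is_deriveZ (- b^-1) (is_derive_expRM (- b) s))).
  by rewrite /GRing.scale/= mulrA mulrNN mulVf ?mul1r// gt_eqF.
rewrite (ge0_FTC_infty _ _ bE).
- by rewrite mulr0 expR0 mulr1 opprK.
- by move=> s _; exact: expR_ge0.
- exact: is_derive_continuous (is_derive_expRM (- b)).
by rewrite -[X in _ --> X](mulr0 (- b^-1)); apply: cvgMr; exact: cvg_expRM.
Qed.

Lemma continuous_EFin_measurable f : continuous f ->
  measurable_fun (`[0, +oo[ : set R) (EFin \o f).
Proof.
move=> fc; apply/measurable_EFinP; apply: measurable_funTS.
exact: continuous_measurable_fun.
Qed.

Lemma exp_bounded_integrable f b K : 0 < b -> continuous f ->
  (forall s, 0 <= s -> `|f s| <= K * expR (- b * s)) ->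
  mu.-integrable `[0, +oo[ (EFin \o f).
Proof.
move=> b0 fc fK.
have gi : mu.-integrable `[0, +oo[ (EFin \o (fun s => K * expR (- b * s))).
  suff ei : mu.-integrable `[0, +oo[ (EFin \o (fun s => expR (- b * s))).
    exact: (integrableZl _ K ei).
  apply/integrableP; split.
    apply: continuous_EFin_measurable.
    exact: is_derive_continuous (is_derive_expRM (- b)).
  under eq_integral do rewrite /= ger0_norm ?expR_ge0//.
  by rewrite FTC_infty_exp// ltry.
apply: le_integrable gi => //.
  exact: continuous_EFin_measurable.
move=> s /=; rewrite in_itv/= andbT => s0.
by rewrite lee_fin (le_trans (fK s s0))// ler_norm.
Qed.

(* Adding a multiple of the exponential bound reduces to a nonnegative integrand. *)
Lemma exp_bounded_FTC_infty F f b K : 0 < b -> continuous f ->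
  (forall s, 0 <= s -> `|f s| <= K * expR (- b * s)) ->
  (forall s, is_derive s (1 : R) F (f s)) ->
  F s @[s --> +oo] --> (0 : R) ->
  (\int[mu]_(s in `[0, +oo[) f s)%R = - F 0.
Proof.
move=> b0 fc fK FE F0.
pose g s := K * expR (- b * s).
have gc : continuous g.
  move=> s; apply: cvgMr.
  exact: is_derive_continuous (is_derive_expRM (- b)) s.
have K0 : 0 <= K.
  by have := le_trans (normr_ge0 _) (fK 0 (lexx _)); rewrite mulr0 expR0 mulr1.
have gi : mu.-integrable `[0, +oo[ (EFin \o g).
  apply: (exp_bounded_integrable (K := K) b0 gc) => s s0.
  by rewrite ger0_norm ?mulr_ge0 ?expR_ge0.
have fi := exp_bounded_integrable b0 fc fK.
have GE s : is_derive s (1 : R) (fun s => - (K / b) * expR (- b * s)) (g s).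
  apply: (is_derive_eq (is_deriveZ (- (K / b)) (is_derive_expRM (- b) s))).
  by rewrite /GRing.scale/= /g; field; rewrite gt_eqF.
have G0 : - (K / b) * expR (- b * s) @[s --> +oo] --> (0 : R).
  by rewrite -[X in _ --> X](mulr0 (- (K / b))); apply: cvgMr; exact: cvg_expRM.
have gE : (\int[mu]_(s in `[0, +oo[) g s)%R = K / b.
  rewrite /Rintegral (ge0_FTC_infty _ gc GE G0)/=.
    by rewrite mulr0 expR0 mulr1 opprK.
  by move=> s _; rewrite mulr_ge0 ?expR_ge0.
have fgE : (\int[mu]_(s in `[0, +oo[) (f s + g s))%R = - F 0 + K / b.
  have FGE s := is_deriveD (FE s) (GE s).
  rewrite /Rintegral (ge0_FTC_infty _ _ FGE)/=.
  - by rewrite fctE mulr0 expR0 mulr1 opprD opprK.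
  - move=> s s0; have := fK s s0; rewrite -/(g s) ler_norml => /andP[+ _].
    by rewrite -subr_ge0 opprK.
  - by move=> s; apply: cvgD; [exact: fc|exact: gc].
  - by rewrite -[X in _ --> X](addr0 0); exact: cvgD.
by move: fgE; rewrite RintegralD// gE => /addIr.
Qed.

End HalfLineIntegral.

(** * Calculus of iterated integrals *)

Section IteratedIntegral.
Variable R : realType.
Local Notation mu := (@lebesgue_measure R).
Implicit Types (f g : seq R -> R) (x y : R).

(** [iterated_integral] is total and carries no integrability, which linearity requires. This
    relation records the value together with the integrability of the integrand at every level. The
    inner value [h s] is prescribed for every [s], not almost every one, so null sets never
    arise. *)
Fixpoint has_iterated_integral (k : nat) f x : Prop :=
  match k with
  | 0 => f [::] = x
  | k'.+1 => exists h : R -> R,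
      [/\ forall s, has_iterated_integral k' (fun t => f (rcons t s)) (h s),
          mu.-integrable `[0, +oo[ (EFin \o h) &
          \int[mu]_(s in `[0, +oo[) h s = x]
  end.

Lemma has_iterated_integralE k f x :
  has_iterated_integral k f x -> iterated_integral k f = x.
Proof.
elim: k f x => [//|k IHk] f x [h [fh _ <-]] /=.
by apply: eq_Rintegral => s _; apply: IHk; exact: fh.
Qed.

Lemma eq_has_iterated_integral k f g x :
  (forall t, size t = k -> f t = g t) ->
  has_iterated_integral k f x -> has_iterated_integral k g x.
Proof.
elim: k f g x => [|k IHk] f g x fg; first by rewrite /= fg.
move=> [h [fh hi hx]]; exists h; split=> // s.
by apply: IHk (fh s) => t tk; rewrite fg// size_rcons tk.
Qed.

Lemma has_iterated_integral0 k : has_iterated_integral k (fun=> 0) 0.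
Proof.
elim: k => [//|k IHk]; exists (fun=> 0); split=> //.
  exact: (integrable0 mu).
by rewrite Rintegral_cst// mul0r.
Qed.

Lemma has_iterated_integralD k f g x y :
  has_iterated_integral k f x -> has_iterated_integral k g y ->
  has_iterated_integral k (fun t => f t + g t) (x + y).
Proof.
elim: k f g x y => [|k IHk] f g x y; first by move=> /= -> ->.
move=> [h [fh hi <-]] [h' [gh' h'i <-]]; exists (fun s => h s + h' s); split.
- by move=> s; apply: IHk; [exact: fh|exact: gh'].
- exact: (integrableD _ hi h'i).
- by rewrite RintegralD.
Qed.

Lemma has_iterated_integralZ k c f x :
  has_iterated_integral k f x ->
  has_iterated_integral k (fun t => c * f t) (c * x).
Proof.
elim: k f x => [|k IHk] f x; first by move=> /= ->.
move=> [h [fh hi <-]]; exists (fun s => c * h s); split.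
- by move=> s; apply: IHk; exact: fh.
- exact: (integrableZl _ c hi).
- by rewrite RintegralZl.
Qed.

Lemma has_iterated_integral_sum (I : finType) k (f : I -> seq R -> R)
    (x : I -> R) :
  (forall i, has_iterated_integral k (f i) (x i)) ->
  has_iterated_integral k (fun t => \sum_i f i t) (\sum_i x i).
Proof.
move=> fx; rewrite (_ : (fun t => _) = \sum_i f i); last first.
  by apply/funext => t; rewrite fct_sumE.
elim/big_rec2: _ => [|i g y _ gy]; first exact: has_iterated_integral0.
exact: has_iterated_integralD.
Qed.

(** The variables of [f] are the innermost ones: they integrate to the constant [x] while those of
    [g] are fixed, so no exchange of integrals is needed. *)
Lemma has_iterated_integralM j k f g x y :
  has_iterated_integral j f x -> has_iterated_integral k g y ->
  has_iterated_integral (j + k) (fun t => f (take j t) * g (drop j t)) (x * y).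
Proof.
move=> fx; elim: k g y => [|k IHk] g y.
  move=> /= <-; rewrite addn0 mulrC.
  apply: eq_has_iterated_integral (has_iterated_integralZ (g [::]) fx) => t <-.
  by rewrite take_size drop_size mulrC.
move=> [h [gh hi <-]]; rewrite addnS; exists (fun s => x * h s); split.
- move=> s; apply: eq_has_iterated_integral (IHk _ _ (gh s)) => t tjk.
  have jt : (j <= size t)%N by rewrite tjk leq_addr.
  by rewrite drop_rcons// -[rcons t s]cats1 takel_cat.
- exact: (integrableZl _ x hi).
- by rewrite RintegralZl.
Qed.

Lemma iterated_integral_ge0 k f :
  (forall t, 0 <= f t) -> 0 <= iterated_integral k f.
Proof.
elim: k f => [|k IHk] f f0 /=; first exact: f0.
by apply: Rintegral_ge0 => s _; exact: IHk.
Qed.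

Definition has_iterated_integral_mx (p q k : nat) (F : seq R -> 'M[R]_(p, q))
    (M : 'M[R]_(p, q)) :=
  forall i j, has_iterated_integral k (fun t => F t i j) (M i j).

Lemma has_iterated_integral_addmx p q k (F G : seq R -> 'M[R]_(p, q)) M N :
  has_iterated_integral_mx k F M -> has_iterated_integral_mx k G N ->
  has_iterated_integral_mx k (fun t => F t + G t) (M + N).
Proof.
move=> FM GN i j; under eq_fun do rewrite mxE.
by rewrite mxE; exact: has_iterated_integralD.
Qed.

Lemma has_iterated_integral_summx (I : finType) p q k
    (F : I -> seq R -> 'M[R]_(p, q)) (M : I -> 'M[R]_(p, q)) :
  (forall l, has_iterated_integral_mx k (F l) (M l)) ->
  has_iterated_integral_mx k (fun t => \sum_l F l t) (\sum_l M l).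
Proof.
move=> FM i j; under eq_fun do rewrite summxE.
by rewrite summxE; apply: has_iterated_integral_sum => l; exact: FM.
Qed.

Lemma has_iterated_integral_mulmx p q r s k (L : 'M[R]_(p, q))
    (F : seq R -> 'M[R]_(q, r)) (N : 'M[R]_(r, s)) M :
  has_iterated_integral_mx k F M ->
  has_iterated_integral_mx k (fun t => L *m F t *m N) (L *m M *m N).
Proof.
move=> FM i j; under eq_fun do rewrite mxE.
rewrite mxE; apply: has_iterated_integral_sum => l.
under eq_fun do rewrite mulrC; rewrite mulrC; apply: has_iterated_integralZ.
under eq_fun do rewrite mxE.
rewrite mxE; apply: has_iterated_integral_sum => l'.
exact: has_iterated_integralZ.
Qed.

Lemma has_iterated_integral_tensmx p q r s j k (F : seq R -> 'M[R]_(p, q))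
    (G : seq R -> 'M[R]_(r, s)) M N :
  has_iterated_integral_mx j F M -> has_iterated_integral_mx k G N ->
  has_iterated_integral_mx (j + k)
    (fun t => F (take j t) *t G (drop j t)) (M *t N).
Proof.
move=> FM GN a b; under eq_fun do rewrite mxE.
rewrite mxE; exact: (has_iterated_integralM (FM _ _) (GN _ _)).
Qed.

End IteratedIntegral.

(** * The integral solution of a linear Lyapunov equation *)

Section LyapunovIntegral.
Variables (R : realType) (n : nat).
Implicit Types A M : 'M[R]_n.+1.
Local Notation mu := (@lebesgue_measure R).

Definition congr_expmx A M (s : R) := expmx (s *: A) *m M *m (expmx (s *: A))^T.

Lemma congr_expmx_bound A M : stable A ->
  exists2 b, 0 < b & exists2 K, 0 <= K &
    forall s i j, 0 <= s -> `|congr_expmx A M s i j| <= K * expR (- b * s).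
Proof.
move=> /stable_expmx_decay[b b0 [K K0 XK]]; exists b => //.
exists (\sum_k \sum_l `|M k l| * K) => [|s i j s0].
  by do 2 (apply: sumr_ge0 => ? _); rewrite mulr_ge0.
rewrite mxE (le_trans (ler_norm_sum _ _ _))// exchange_big mulr_suml.
apply: ler_sum => l _; rewrite !mxE mulr_suml (le_trans (ler_norm_sum _ _ _))//.
rewrite mulr_suml; apply: ler_sum => k _.
by rewrite mulrAC mulrC normrM -mulrA ler_wpM2l ?XK.
Qed.

Lemma congr_expmx_continuous A M i j :
  continuous (fun s => congr_expmx A M s i j).
Proof. exact: is_derive_continuous (fun s => mxderive_lyapunov A M s i j). Qed.

(** [A *m L + L *m A^T] is the integral of the derivative of [congr_expmx A M], a function that
    starts at [M] and tends to 0. *)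
Lemma integral_congr_expmx A M : stable A ->
  exists L : 'M[R]_n.+1,
  [/\ forall i j,
        mu.-integrable `[0, +oo[ (EFin \o fun s => congr_expmx A M s i j),
      forall i j, \int[mu]_(s in `[0, +oo[) congr_expmx A M s i j = L i j &
      A *m L + L *m A^T + M = 0].
Proof.
move=> sA; have [b b0 [K K0 PhiK]] := congr_expmx_bound M sA.
have Phii i j :
    mu.-integrable `[0, +oo[ (EFin \o fun s => congr_expmx A M s i j).
  apply: (exp_bounded_integrable b0 (@congr_expmx_continuous A M i j)) => s.
  exact: PhiK.
pose L : 'M[R]_n.+1 :=
  \matrix_(i, j) \int[mu]_(s in `[0, +oo[) congr_expmx A M s i j.
exists L; split=> // [i j|]; first by rewrite mxE.
(* Read as an iterated integral in one variable, so that the rule for multiplication by constant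
   matrices applies. *)
pose Phi (t : seq R) := congr_expmx A M (last 0 t).
have PhiL : has_iterated_integral_mx 1 Phi L.
  move=> i j; exists (fun s => congr_expmx A M s i j).
  by split=> //; rewrite mxE.
have := has_iterated_integral_addmx (has_iterated_integral_mulmx A 1%:M PhiL)
  (has_iterated_integral_mulmx 1%:M A^T PhiL).
rewrite !mulmx1 !mul1mx => dPhiL.
apply/eqP; rewrite addr_eq0; apply/eqP/matrixP => i j.
rewrite -(has_iterated_integralE (dPhiL i j)) [RHS]mxE.
rewrite (_ : M i j = congr_expmx A M 0 i j); last first.
  by rewrite /congr_expmx expmx0 mul1mx trmx1 mulmx1.
pose D s := A *m congr_expmx A M s + congr_expmx A M s *m A^T.
have dPhi s := @mxderive_lyapunov R n.+1 A M s.
have Dc : continuous (fun s => D s i j).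
  have dD s := mxderive_addmx
    (mxderive_mulmx (@mxderive_cst R _ _ A s) (dPhi s))
    (mxderive_mulmx (dPhi s) (@mxderive_cst R _ _ A^T s)).
  exact: is_derive_continuous (fun s => dD s i j).
have DK s : 0 <= s ->
    `|D s i j| <= (\sum_k (`|A i k| * K + K * `|A j k|)) * expR (- b * s).
  move=> s0; rewrite !mxE -big_split/= mulr_suml.
  apply: le_trans (ler_norm_sum _ _ _) _; apply: ler_sum => k _.
  rewrite (le_trans (ler_normD _ _))// !normrM [A^T k j]mxE mulrDl lerD//.
    by rewrite -mulrA ler_wpM2l// PhiK.
  by rewrite mulrAC ler_wpM2r// PhiK.
have Phi0 : congr_expmx A M s i j @[s --> +oo] --> (0 : R).
  apply/cvgr0Pnorm_le => e e0.
  have Ke0 : K * expR (- b * s) @[s --> +oo] --> (0 : R).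
    by rewrite -[X in _ --> X](mulr0 K); apply: cvgMr; exact: cvg_expRM.
  near=> s; have s0 : 0 <= s by near: s; exact: nbhs_pinfty_ge.
  apply: le_trans (PhiK s i j s0) _; apply: le_trans (ler_norm _) _.
  by near: s; move/cvgr0Pnorm_le : Ke0; exact.
rewrite -(exp_bounded_FTC_infty b0 Dc DK (fun s => dPhi s i j) Phi0).
by apply: eq_Rintegral => s _ /=; rewrite !mulmx1 !mul1mx.
Unshelve. all: by end_near. Qed.

(** The new variable is outermost: for fixed [s] the inner integrals see [F] between two constant
    matrices, and only [M] is left under the last integral. *)
Lemma has_iterated_integral_lyapunov A k (F : seq R -> 'M[R]_n.+1) M :
  stable A -> has_iterated_integral_mx k F M ->
  exists2 L, has_iterated_integral_mx k.+1
    (fun t => congr_expmx A (F (take k t)) (nth 0 t k)) L &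
    A *m L + L *m A^T + M = 0.
Proof.
move=> sA FM; have [L [Li LE ML]] := integral_congr_expmx M sA.
exists L => // i j; exists (fun s => congr_expmx A M s i j); split=> // s.
have := has_iterated_integral_mulmx (expmx (s *: A)) (expmx (s *: A))^T FM i j.
apply: eq_has_iterated_integral => t tk.
by rewrite nth_rcons tk ltnn eqxx -cats1 take_size_cat.
Qed.

End LyapunovIntegral.

(** * Gram matrices of block and Kronecker products *)

Section GramMatrix.
Variable R : realType.

Lemma sum_mxtens_index (p q : nat) (F : 'I_(p * q) -> R) :
  \sum_c F c = \sum_k \sum_l F (mxtens_index (k, l)).
Proof.
rewrite pair_big (reindex (@mxtens_index p q))/=.
  by apply: eq_bigr => -[].
by apply: onW_bij; exists (@mxtens_unindex p q);
  [exact: mxtens_indexK|exact: mxtens_unindexK].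
Qed.

(** The right factor is block diagonal with blocks [X], so only the k-th block of [hcat N]
    contributes. *)
Lemma hcat_tens1mxE (n m q : nat) (N : 'I_m -> 'M[R]_n) (X : 'M[R]_(n, q))
    i k l :
  (hcat N *m ((1%:M : 'M[R]_m) *t X)) i (mxtens_index (k, l)) = (N k *m X) i l.
Proof.
rewrite !mxE sum_mxtens_index (bigD1 k)//= [X in _ + X]big1 ?addr0 => [|k' k'k].
  by apply: eq_bigr => l' _; rewrite !mxE !mxtens_indexK/= eqxx mul1r.
apply: big1 => l' _; rewrite !mxE !mxtens_indexK/= (negbTE k'k).
by rewrite mul0r mulr0.
Qed.

Lemma hcat_gram (n m q : nat) (N : 'I_m -> 'M[R]_n) (X : 'M[R]_(n, q)) :
  let Y := hcat N *m ((1%:M : 'M[R]_m) *t X) in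
  Y *m Y^T = \sum_k N k *m (X *m X^T) *m (N k)^T.
Proof.
apply/matrixP => i j; rewrite mxE sum_mxtens_index summxE.
apply: eq_bigr => k _; under eq_bigr do rewrite [X in _ * X]mxE !hcat_tens1mxE.
rewrite mulmxA -[RHS]/((_ *m (N k)^T) i j) -mulmxA -trmx_mul [RHS]mxE.
by apply: eq_bigr => l _; rewrite [X in _ = _ * X]mxE.
Qed.

Lemma mulmx_gram (n p q : nat) (E : 'M[R]_(n, p)) (X : 'M[R]_(p, q)) :
  (E *m X) *m (E *m X)^T = E *m (X *m X^T) *m E^T.
Proof. by rewrite trmx_mul !mulmxA. Qed.

Lemma tensmx_gram (n p q : nat) (X : 'M[R]_(n, p)) (Y : 'M[R]_(n, q)) :
  (X *t Y) *m (X *t Y)^T = (X *m X^T) *t (Y *m Y^T).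
Proof. by rewrite trmx_tens tensmx_mul. Qed.

End GramMatrix.

(** * The recurrence for the terms of the Gramian *)

Definition gram (R : realType) (n : nat) (w : wmx R n) : 'M[R]_n :=
  projT2 w *m (projT2 w)^T.

Section GramianTerm.
Variables (R : realType) (n m : nat) (A : 'M[R]_n.+1).
Variables (H : 'M[R]_(n.+1, n.+1 * n.+1)) (N : 'I_m -> 'M[R]_n.+1).
Variable B : 'M[R]_(n.+1, m).
Let G i t : 'M[R]_n.+1 := gram (Pbar A H N B i t).
Let T := gramian_term A H N B.

Lemma gram_Pbar0 t : G 0 t = 0.
Proof. by rewrite /G /gram/= mul0mx. Qed.

(* [gram_Pbar0] makes the dummy [Pbar 0] contribute nothing to the sum below, so
   that one recurrence covers the three cases in the definition of [Pbar]. *)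
Definition lyapunov_source (i : nat) (X : 'I_i.+1 -> 'M[R]_(n.+1 * n.+1))
    (Y : 'M[R]_n.+1) : 'M[R]_n.+1 :=
  H *m (\sum_j X j) *m H^T + \sum_k N k *m Y *m (N k)^T +
  (if i is 0 then B *m B^T else 0).

Lemma gram_Pbar_rcons i s u : size s = i ->
  G i.+1 (rcons s u) = congr_expmx A
    (lyapunov_source
      (fun j : 'I_i.+1 => G j (take j s) *t G (i - j)%N (drop j s))
      (G i s)) u.
Proof.
rewrite /congr_expmx; case: i => [|[|k]] si.
- have -> : s = [::] by case: s si.
  rewrite {1}/G [Pbar _ _ _ _ _ _]Pbar1E /gram mulmx_gram.
  congr (_ *m _ *m _); rewrite /lyapunov_source big_ord1 /= !gram_Pbar0 tens0mx.
  by rewrite mulmx0 mul0mx add0r big1 ?add0r// => l _; rewrite mulmx0 mul0mx.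
(* Both Kronecker terms contain the factor [G 0], so only the sum over the [N k] survives. *)
- have [v ->] : exists v, s = [:: v] by case: s si => [|v []]// _; exists v.
  rewrite {1}/G [Pbar _ _ _ _ _ _]Pbar2E /gram mulmx_gram.
  congr (_ *m _ *m _); rewrite hcat_gram.
  rewrite /lyapunov_source !big_ord_recl big_ord0 /= !gram_Pbar0.
  by rewrite tens0mx tensmx0 !addr0 mulmx0 mul0mx add0r.
rewrite {1}/G Pbar_rcons// /gram mulmx_gram; congr (_ *m _ *m _).
rewrite tr_row_mx mul_row_col mulmx_gram hcat_gram tr_mxrow mul_mxrow_mxcol.
rewrite /lyapunov_source addr0; congr (_ *m _ *m _ + _).
(* The first and last terms contain [G 0]; the inner ones, shifted by one, match the blocks of
   [Pbar]. *)
rewrite [RHS]big_ord_recl [X in _ = _ + X]big_ord_recr/=.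
rewrite [bump 0 k.+1]add1n subnn !gram_Pbar0 tens0mx tensmx0 add0r addr0.
by apply: eq_bigr => j _; rewrite tensmx_gram.
Qed.

(** Integrability and equation come from one strong induction: the integrals of [G 0], ..., [G i]
    give that of the source, and the Lyapunov integral of the source is that of [G i.+1].
    Convergence of the Gramian series is not involved. *)
Lemma gramian_term_spec : stable A -> forall i,
  has_iterated_integral_mx i (G i) (T i) /\
  A *m T i.+1 + T i.+1 *m A^T +
    lyapunov_source (fun j : 'I_i.+1 => T j *t T (i - j)%N) (T i) = 0.
Proof.
move=> sA.
have TE i M : has_iterated_integral_mx i (G i) M -> T i = M.
  move=> GM; apply/matrixP => a b; rewrite mxE.
  exact: has_iterated_integralE (GM a b).
have step i :
  (forall j, (j <= i)%N -> has_iterated_integral_mx j (G j) (T j)) ->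
  has_iterated_integral_mx i.+1 (G i.+1) (T i.+1) /\
  A *m T i.+1 + T i.+1 *m A^T +
    lyapunov_source (fun j : 'I_i.+1 => T j *t T (i - j)%N) (T i) = 0.
  move=> GT.
  have src : has_iterated_integral_mx i (fun s => lyapunov_source
      (fun j : 'I_i.+1 => G j (take j s) *t G (i - j)%N (drop j s)) (G i s))
      (lyapunov_source (fun j : 'I_i.+1 => T j *t T (i - j)%N) (T i)).
    apply: has_iterated_integral_addmx.
      apply: has_iterated_integral_addmx.
        apply: has_iterated_integral_mulmx.
        apply: has_iterated_integral_summx => j.
        have ji : (j <= i)%N by rewrite -ltnS.
        (* Splits the [i] variables into the first [j] and the last [i - j], one group for each
           Kronecker factor. *)
        rewrite -{1}(subnKC ji); apply: has_iterated_integral_tensmx.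
          exact: GT.
        by apply: GT; exact: leq_subr.
      apply: has_iterated_integral_summx => k.
      by apply: has_iterated_integral_mulmx; exact: GT.
    move=> a b; case: i {GT} => [//|i].
    by under eq_fun do rewrite mxE; rewrite mxE; exact: has_iterated_integral0.
  have [L GL LE] := has_iterated_integral_lyapunov sA src.
  have GL' : has_iterated_integral_mx i.+1 (G i.+1) L.
    move=> a b; apply: eq_has_iterated_integral (GL a b) => t.
    case/lastP: t => // t u; rewrite size_rcons => -[ti].
    rewrite gram_Pbar_rcons// nth_rcons ti ltnn eqxx.
    by rewrite -cats1 -ti take_size_cat.
  by rewrite (TE _ _ GL').
have GT i : forall j, (j <= i)%N -> has_iterated_integral_mx j (G j) (T j).
  elim: i => [|i IHi] j.
    by rewrite leqn0 => /eqP-> a b; rewrite /= [RHS]mxE.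
  rewrite leq_eqVlt ltnS => /predU1P[->|]; last exact: IHi.
  by have [] := step i IHi.
by move=> i; split; [exact: (GT i)|have [] := step i (GT i)].
Qed.

End GramianTerm.

(** * Convergence of Cauchy products *)

Section CauchyProduct.
Variable R : realType.

(** Both sides run over the pairs with [j + l < n]. *)
Lemma sum_triangle (F : nat -> nat -> R) n :
  \sum_(0 <= i < n) \sum_(j < i.+1) F j (i - j)%N =
  \sum_(0 <= j < n) \sum_(0 <= l < n - j) F j l.
Proof.
elim: n => [|n IHn]; first by rewrite !big_nil.
rewrite big_nat_recr//= IHn big_ord_recr/= big_nat_recr//= subnn subSnn.
rewrite big_nat1 addrA; congr (_ + _).
rewrite -(big_mkord xpredT (fun j => F j (n - j)%N)) -big_split/=.
apply: eq_big_nat => j /andP[_ jn].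
by rewrite subSn ?(ltnW jn)// big_nat_recr.
Qed.

(** The product of partial sums exceeds the triangle by the pairs with [j + l >= n]. One index of
    such a pair is at least [n %/ 2], and either case costs at most the sum of [tau] times its tail
    from there; hence the factor 2 in [d]. *)
Lemma cvg_cauchy_product (x y tau : R^nat) (X Y : R) :
  (forall i, `|x i| <= tau i) -> (forall i, `|y i| <= tau i) ->
  cvgn (series tau) -> series x n @[n --> \oo] --> X ->
  series y n @[n --> \oo] --> Y ->
  \sum_(0 <= i < n) \sum_(j < i.+1) x j * y (i - j)%N @[n --> \oo] --> X * Y.
Proof.
move=> xt yt ct xX yY.
have t0 i : 0 <= tau i := le_trans (normr_ge0 _) (xt i).
pose S := limn (series tau).
have tmon : {homo series tau : a b / (a <= b)%N >-> a <= b}.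
  exact: nondecreasing_series.
have tS n : series tau n <= S by exact: nondecreasing_cvgn_le.
have S0 : 0 <= S by have := tS 0; rewrite /series/= big_nil.
pose d n := 2 * S * (S - series tau (n %/ 2)%N).
have d0 : d n @[n --> \oo] --> 0.
  rewrite -[X in _ --> X](mulr0 (2 * S)); apply: cvgMr.
  rewrite -[X in _ --> X](subrr S); apply: cvgB; first exact: cvg_cst.
  by apply: cvg_comp ct; exact: cvg_divnr.
have dle n : `|series x n * series y n -
    \sum_(0 <= i < n) \sum_(j < i.+1) x j * y (i - j)%N| <= d n.
  rewrite (sum_triangle (fun j l => x j * y l)).
  rewrite /series/= mulr_suml -sumrB.
  apply: le_trans (ler_norm_sum _ _ _) _.
  (* For [j < h] the missing inner sum starts beyond [h]; for [h <= j] the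
     factor [tau j] itself lies in the tail. *)
  pose h := (n %/ 2)%N.
  have hn : (h <= n)%N by exact: leq_div.
  have bound j : (0 <= j < n)%N ->
    `|x j * series y n - \sum_(0 <= l < n - j) x j * y l| <=
    tau j * (S - series tau h) + (if (h <= j)%N then tau j * S else 0).
    move=> /= jn.
    rewrite -mulr_sumr -mulrBr normrM sub_series_geq ?leq_subr//.
    apply: (@le_trans _ _ (tau j * (series tau n - series tau (n - j)%N))).
      rewrite ler_pM// sub_series_geq ?leq_subr//.
      by apply: le_trans (ler_norm_sum _ _ _) _; exact: ler_sum.
    case: leqP => hj.
      rewrite -mulrDr ler_wpM2l//.
      have tj0 : 0 <= series tau (n - j)%N by exact: sumr_ge0.
      by have := tS n; have := tS h; lra.
    rewrite addr0 ler_wpM2l// lerB// tmon//.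
    rewrite leq_subRL ?(ltnW jn)// (leq_trans (leq_add (ltnW hj) (leqnn h)))//.
    by rewrite addnn -muln2 leq_trunc_div.
  apply: le_trans (ler_sum_nat bound) _.
  have tail : \sum_(0 <= j < n) (if (h <= j)%N then tau j * S else 0) =
      (series tau n - series tau h) * S.
    rewrite sub_series_geq// mulr_suml (big_cat_nat (n := h))//=.
    rewrite [X in X + _]big_nat_cond [X in X + _]big1 ?add0r => [|j].
      by apply: eq_big_nat => j /andP[-> _].
    by rewrite andbT => /= jh; rewrite leqNgt jh.
  rewrite big_split/= -mulr_suml tail -/(series tau n) /d -/h.
  rewrite (_ : 2 * S * _ = S * (S - series tau h) + (S - series tau h) * S).
    apply: lerD; last by rewrite ler_wpM2r// lerB.
    by apply: ler_wpM2r; [rewrite subr_ge0|]; exact: tS.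
  by ring.
have D0 : series x n * series y n -
    \sum_(0 <= i < n) \sum_(j < i.+1) x j * y (i - j)%N
    @[n --> \oo] --> (0 : R).
  apply/norm_cvg0P; apply: (@squeeze_cvgr _ _ _ _ (fun=> 0) d) d0.
    by near=> n; rewrite normr_ge0 dle.
  exact: cvg_cst.
rewrite (_ : (fun n => _) = fun n => series x n * series y n -
    (series x n * series y n -
      \sum_(0 <= i < n) \sum_(j < i.+1) x j * y (i - j)%N)).
  rewrite -[X in _ --> X]subr0; apply: cvgB D0; exact: cvgM.
by apply/funext => n; rewrite subKr.
Unshelve. all: by end_near. Qed.

End CauchyProduct.

(** * Trace bounds and summation of the Lyapunov equations *)

Section GramianTrace.
Variable R : realType.

(** In each column, a product of two entries is at most the sum of squares of that column, and these
    sums add up to the trace. *)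
Lemma normr_gram_le_trace (n : nat) (w : wmx R n) a b :
  `|gram w a b| <= \tr (gram w).
Proof.
rewrite mxE /mxtrace; under [leRHS]eq_bigr do rewrite mxE.
rewrite exchange_big/=; apply: le_trans (ler_norm_sum _ _ _) _.
apply: ler_sum => q _; under [leRHS]eq_bigr do rewrite mxE -expr2.
rewrite mxE; have sqr_le c : projT2 w c q ^+ 2 <= \sum_i projT2 w i q ^+ 2.
  by rewrite (bigD1 c)//= lerDl sumr_ge0// => i _; exact: sqr_ge0.
exact: normrM_le_sqr.
Qed.

Variables (n m : nat) (A : 'M[R]_n.+1) (H : 'M[R]_(n.+1, n.+1 * n.+1))
  (N : 'I_m -> 'M[R]_n.+1) (B : 'M[R]_(n.+1, m)).
Let G i t : 'M[R]_n.+1 := gram (Pbar A H N B i t).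
Let T := gramian_term A H N B.

Lemma normr_gramian_term_le_trace i a b : stable A -> `|T i a b| <= \tr (T i).
Proof.
move=> sA; have [GT _] := gramian_term_spec H N B sA i.
have trGT : has_iterated_integral i (fun t => \tr (G i t)) (\tr (T i)).
  by apply: has_iterated_integral_sum => c; exact: GT.
(* The signs [c = 1] and [c = -1] replace the absolute value: the combination stays linear in [G],
   and its integrand is nonnegative by the pointwise bound. *)
have pm c : `|c| = 1 -> 0 <= \tr (T i) + c * T i a b.
  move=> c1.
  have := has_iterated_integralD trGT (has_iterated_integralZ c (GT a b)).
  move=> /has_iterated_integralE <-; apply: iterated_integral_ge0 => t.
  have := normr_gram_le_trace (Pbar A H N B i t) a b.
  rewrite -[X in X <= _]mul1r -c1 -normrM ler_norml => /andP[+ _].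
  by rewrite -subr_ge0 opprK addrC.
have := pm 1 (normr1 _); have := pm (-1) (normrN1 _).
by move=> *; rewrite ler_norml; apply/andP; split; lra.
Qed.

Lemma gramian_term0 : T 0 = 0.
Proof. by apply/matrixP => a b; rewrite mxE/= mul0mx. Qed.

Lemma gramian_partial_sumE k :
  gramian_partial_sum A H N B k = \sum_(0 <= i < k.+1) T i.
Proof.
by rewrite big_nat_recl// gramian_term0 add0r /gramian_partial_sum big_add1.
Qed.

Lemma gramian_lyapunov_equation :
  stable A -> reachability_gramian_exists A H N B ->
  let P := reachability_gramian A H N B in
  A *m P + P *m A^T + H *m (P *t P) *m H^T
    + \sum_(k < m) N k *m P *m (N k)^T + B *m B^T = 0.
Proof.
move=> sA cP P.
pose S k := \sum_(0 <= i < k) T i.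
have SP : S k @[k --> \oo] --> P.
  have : gramian_partial_sum A H N B k @[k --> \oo] --> P := cP.
  by under eq_fun do rewrite gramian_partial_sumE; rewrite (cvg_shiftS S).
have SE k a b : S k a b = series (fun i => T i a b) k by rewrite summxE.
pose C k := \sum_(0 <= i < k) \sum_(j < i.+1) T j *t T (i - j)%N.
have CP : C k @[k --> \oo] --> P *t P.
  apply: cvg_mx_coord => a b; rewrite mxE.
  have SPc c d : series (fun i => T i c d) k @[k --> \oo] --> P c d.
    by under eq_fun do rewrite -SE; exact: mx_coord_cvg.
  (* The traces are summable because the diagonal entries of the partial sums converge; they
     dominate all entries in the Cauchy products below. *)
  have trcvg : cvgn (series (fun i => \tr (T i))).
    apply/cvg_ex; exists (\tr P); rewrite /series/=.
    under eq_fun do rewrite exchange_big/=.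
    by apply: cvg_sumr => c; exact: SPc.
  rewrite (_ : (fun k => C k a b) = fun k => \sum_(0 <= i < k) \sum_(j < i.+1)
      T j (mxtens_unindex a).1 (mxtens_unindex b).1 *
      T (i - j)%N (mxtens_unindex a).2 (mxtens_unindex b).2); last first.
    apply/funext => k; rewrite summxE; apply: eq_bigr => i _.
    by rewrite summxE; apply: eq_bigr => j _; rewrite mxE.
  apply: (cvg_cauchy_product _ _ trcvg (SPc _ _) (SPc _ _)) => i;
    exact: normr_gramian_term_le_trace.
(* Sum of the equations for [i = 0], ..., [k]. The unknown has index [i.+1] and the source index
   [i], hence the partial sums of different lengths; [B *m B^T] enters only at [i = 0]. *)
have eqS k : A *m S k.+2 + S k.+2 *m A^T + H *m C k.+1 *m H^T
    + \sum_l N l *m S k.+1 *m (N l)^T + B *m B^T = 0.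
  have -> : S k.+2 = \sum_(0 <= i < k.+1) T i.+1.
    by rewrite /S big_nat_recl// gramian_term0 add0r.
  elim: k => [|k IHk].
    have [_] := gramian_term_spec H N B sA 0.
    by rewrite /S /C /lyapunov_source !big_nat1 !addrA.
  have [_ E] := gramian_term_spec H N B sA k.+1.
  rewrite big_nat_recr//= -[RHS]addr0 -[X in _ = X + _]IHk -[X in _ = _ + X]E.
  rewrite /C /S !(big_nat_recr k.+1)//= /lyapunov_source addr0.
  rewrite !(mulmxDr, mulmxDl).
  have -> : \sum_l N l *m (\sum_(0 <= i < k.+1) T i + T k.+1) *m (N l)^T =
      \sum_l N l *m (\sum_(0 <= i < k.+1) T i) *m (N l)^T +
      \sum_l N l *m T k.+1 *m (N l)^T.
    by rewrite -big_split; apply: eq_bigr => l _; rewrite mulmxDr mulmxDl.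
  (* The odd positions form [IHk], the even ones [E]. *)
  by rewrite !addrA [LHS](ACl (1*3*5*7*9*2*4*6*8)).
have SP1 : S k.+1 @[k --> \oo] --> P by rewrite (cvg_shiftS S).
have SP2 : S k.+2 @[k --> \oo] --> P by rewrite (cvg_shiftS (fun k => S k.+1)).
have CP1 : C k.+1 @[k --> \oo] --> P *t P by rewrite (cvg_shiftS C).
have lim : A *m S k.+2 + S k.+2 *m A^T + H *m C k.+1 *m H^T
    + \sum_l N l *m S k.+1 *m (N l)^T + B *m B^T @[k --> \oo] -->
    A *m P + P *m A^T + H *m (P *t P) *m H^T
    + \sum_l N l *m P *m (N l)^T + B *m B^T.
  apply: cvg_addmx; last exact: cvg_cst.
  apply: cvg_addmx; last first.
    by apply: cvg_summx => l; apply: cvg_mulmxr; exact: cvg_mulmxl.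
  apply: cvg_addmx; last by apply: cvg_mulmxr; exact: cvg_mulmxl.
  by apply: cvg_addmx; [exact: cvg_mulmxl|exact: cvg_mulmxr].
apply/matrixP => a b.
have /(cvg_lim (@Rhausdorff R)) <- := @mx_coord_cvg _ _ _ _ _ a b lim.
by under eq_fun do rewrite eqS; rewrite lim_cst.
Qed.

End GramianTrace.

Theorem theorem3p1 (R : realType) (n m p : nat)
    (A : 'M[R]_n) (H : 'M[R]_(n, n * n)) (N : 'I_m -> 'M[R]_n)
    (B : 'M[R]_(n, m)) (C : 'M[R]_(p, n)) :
  stable A ->
  reachability_gramian_exists A H N B ->
  let P := reachability_gramian A H N B in
  A *m P + P *m A^T + H *m (P *t P) *m H^T
    + \sum_(k < m) N k *m P *m (N k)^T + B *m B^T = 0.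
Proof.
move=> sA cP P.
(* In dimension 0 the equation has no entries; otherwise the square matrices form a nonzero ring, as
   the lemmas above assume. *)
case: n A H N B C sA cP @P => [|n'] A H N B C sA cP P.
  by apply/matrixP => -[].
exact: gramian_lyapunov_equation.
Qed.
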